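(* Let ${\bm{P}}\succ0$ and ${\bm{H}}\succeq0$ be symmetric $d\times d$ matrices with ${\bm{P}}{\bm{H}}={\bm{H}}{\bm{P}}$, and let $\tilde\lambda_1\ge\cdots\ge\tilde\lambda_d>0$ be the eigenvalues of ${\bm{P}}^{-1}{\bm{H}}$. Fix $\eta>0$, $\beta_1\in[0,1)$, and set $\tilde\eta:=(1-\beta_1)\eta$. Let $\sigma_1,\ldots,\sigma_d>0$ be such that, in an orthonormal basis simultaneously diagonalizing ${\bm{P}}$ and ${\bm{H}}$, ${\bm{P}}=\mathrm{diag}(\sigma_1,\ldots,\sigma_d)$ and ${\bm{P}}^{-1/2}{\bm{H}}{\bm{P}}^{-1/2}=\mathrm{diag}(\tilde\lambda_1,\ldots,\tilde\lambda_d)$. Let ${\mathcal{X}}:=(\mathbb{S}^2)^d$, ${\mathcal{K}}:=(\mathbb{S}^2_+)^d$, and define ${\mathcal{T}}_{\mathrm{adam}}:{\mathcal{X}}\to{\mathcal{X}}$ by \[ ({\mathcal{T}}_{\mathrm{adam}}({\bm{W}}))_i={\bm{A}}_i{\bm{W}}_i{\bm{A}}_i^\top+\tilde\eta^2\Bigl(\tilde\lambda_i^2({\bm{W}}_i)_{11}+\sigma_i^{-1}\sum_{j=1}^d\sigma_j\tilde\lambda_j^2({\bm{W}}_j)_{11}\Bigr){\bm{Q}},\quad i=1,\ldots,d, \] with ${\bm{A}}_i=\begin{bmatrix}1-\tilde\eta\tilde\lambda_i&-\beta_1\\ \tilde\eta\tilde\lambda_i&\beta_1\end{bmatrix}$,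 ${\bm{Q}}=\begin{bmatrix}1&-1\\-1&1\end{bmatrix}$. Let $S_{\mathrm{adam}}(\eta,\beta_1):=\sum_{i=1}^d\frac{\eta\tilde\lambda_i}{2\left(1-\frac{\eta\tilde\lambda_i}{1+\beta_1}\right)}$. Then: (a) ${\mathcal{T}}_{\mathrm{adam}}({\mathcal{K}})\subseteq{\mathcal{K}}$; moreover ${\mathcal{T}}_{\mathrm{adam}}$ has an eigenvalue equal to its spectral radius $\rho({\mathcal{T}}_{\mathrm{adam}})$ with an associated eigenvector ${\bm{W}}^\star\in{\mathcal{K}}\setminus\{{\bm{0}}\}$, and $\rho({\mathcal{T}}_{\mathrm{adam}})\ge\tilde\eta^2\sum_{i=1}^d\tilde\lambda_i^2>0$ and $\sum_{i=1}^d({\bm{W}}_i^\star)_{11}>0$. (b) $\rho({\mathcal{T}}_{\mathrm{adam}})=1$ if and only if $\eta\tilde\lambda_1<1+\beta_1$ and $S_{\mathrm{adam}}(\eta,\beta_1)=1$. (c) $\rho({\mathcal{T}}_{\mathrm{adam}})<1$ if and only if $\eta\tilde\lambda_1<1+\beta_1$ and $S_{\mathrm{adam}}(\eta,\beta_1)<1$.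
   Context: $\mathbb{S}^2$ denotes the space of real symmetric $2\times2$ matrices and $\mathbb{S}^2_+$ the cone of positive semidefinite ones; $\rho(\cdot)$ denotes spectral radius. *)

(* Defs.v *)
From HB Require Import structures.
From mathcomp Require Import all_boot all_order all_algebra.
From mathcomp Require Import complex.
From mathcomp Require Import classical_sets reals.

Set Implicit Arguments.
Unset Strict Implicit.
Unset Printing Implicit Defensive.

Import Order.TTheory GRing.Theory Num.Theory.
Local Open Scope ring_scope.
Local Open Scope complex_scope.

Definition sym2 {K : nzRingType} (W : 'M[K]_2) : Prop := W^T = W.

Definition psd2 {R : realFieldType} (W : 'M[R]_2) : Prop :=
  sym2 W /\ forall x : 'cV[R]_2, 0 <= (x^T *m W *m x) 0 0.

Definition inX {K : nzRingType} {d : nat} (W : 'I_d -> 'M[K]_2) : Prop :=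
  forall i, sym2 (W i).
Definition inK {R : realFieldType} {d : nat} (W : 'I_d -> 'M[R]_2) : Prop :=
  forall i, psd2 (W i).
Definition nonzeroX {K : nzRingType} {d : nat} (W : 'I_d -> 'M[K]_2) : Prop :=
  exists i, W i != 0.

Definition Qmx {K : nzRingType} : 'M[K]_2 :=
  \matrix_(i < 2, j < 2) (if i == j then 1 else -1).

Definition Amx {K : nzRingType} (et b1 l : K) : 'M[K]_2 :=
  \matrix_(i < 2, j < 2)
    (if i == 0 then (if j == 0 then 1 - et * l else - b1)
               else (if j == 0 then et * l else b1)).

(* T_adam, written over an arbitrary field K (K = R for the operator on X,
   K = R[i] for its complexification). Parameters: eta, beta1, lam_i
   (= tilde lambda_i), sig_i (= sigma_i).  tilde eta = (1 - beta1) eta. *)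
Definition Tadam {K : fieldType} {d : nat} (eta b1 : K) (lam sig : 'I_d -> K)
    (W : 'I_d -> 'M[K]_2) (i : 'I_d) : 'M[K]_2 :=
  let et := (1 - b1) * eta in
  Amx et b1 (lam i) *m W i *m (Amx et b1 (lam i))^T
  + (et ^+ 2 * (lam i ^+ 2 * W i 0 0
       + (sig i)^-1 * \sum_(j < d) sig j * lam j ^+ 2 * W j 0 0)) *: Qmx.

(* z \in C is an eigenvalue of the real linear operator T_adam on X, i.e.
   an eigenvalue of its complexification X_C = (S^2(C))^d. *)
Definition Tadam_eigenvalue {R : realType} {d : nat} (eta b1 : R)
    (lam sig : 'I_d -> R) (z : R[i]) : Prop :=
  exists W : 'I_d -> 'M[R[i]]_2,
    inX W /\ nonzeroX W /\
    forall i, Tadam (eta%:C) (b1%:C) (fun j => (lam j)%:C) (fun j => (sig j)%:C)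
                    W i = z *: W i.

Definition cmod {R : rcfType} (z : R[i]) : R := ComplexField.Normc.normc z.

Definition rho_adam {R : realType} {d : nat} (eta b1 : R)
    (lam sig : 'I_d -> R) : R :=
  reals.sup [set cmod z | z in [set z | Tadam_eigenvalue eta b1 lam sig z]]%classic.

Definition S_adam {R : realFieldType} {d : nat} (eta b1 : R) (lam : 'I_d -> R) : R :=
  \sum_(i < d) (eta * lam i) / (2 * (1 - eta * lam i / (1 + b1))).

(* Main.v *)
Require Import Defs.
From HB Require Import structures.
From mathcomp Require Import all_boot all_order all_algebra.
From mathcomp Require Import complex.
From mathcomp Require Import classical_sets reals.
From mathcomp Require Import ring lra.

Import Order.TTheory GRing.Theory Num.Theory.
Import ComplexField.Normc.
Local Open Scope ring_scope.
Local Open Scope complex_scope.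

(* Put a_i = (1 - b) eta lam_i, c_i = 1 + b - a_i and
     k_i(x) = (x - b) ((x + b)^2 - c_i^2 x) / (x (x + b)).
   Eliminating two of the three coordinates of each W_i, z (nonzero and different
   from -b) is an eigenvalue with first entries p_i iff
   sig_i p_i (k_i(z) - a_i^2) = sum_j sig_j a_j^2 p_j for all i, which leads to the
   secular equation F(x) = sum_i a_i^2 / (k_i(x) - a_i^2) = 1.  On the real half-line
   where x > b and all k_i(x) > a_i^2, each k_i is increasing, so F is decreasing
   and takes the value 1 at exactly one point rho; its eigenvector is positive
   definite because k_i(rho) > 0.  Since |k_i(z)| >= k_i(|z|) for |z| > b, an eigenvalue
   with |z| > rho would satisfy 1 <= F(|z|) < F(rho) = 1, so rho is the spectral
   radius.  Finally k_i(1) - a_i^2 = 2 a_i (1 - b) (1 - eta lam_i / (1 + b)), so F(1) is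
   S_adam, and monotonicity compares rho with 1. *)

(** * The function k on the half-line beyond b *)

(* In the coordinates p = W_11, q = W_11 + W_12, r = W_11 + 2 W_12 + W_22 the map
   W |-> A W A^T is p' = c^2 p - 2 b c q + b^2 r, q' = c p - b q, r' = p with
   c = 1 + b - et lam.  Eliminating q and r from x q = q' and x r = r' turns
   x p = p' + t into kfun b c x * p = t. *)
Definition kfun {K : fieldType} (b c x : K) : K :=
  x - b ^+ 2 / x - c ^+ 2 * (x - b) / (x + b).

Lemma kfun_factor {K : fieldType} (b c x : K) : x != 0 -> x + b != 0 ->
  kfun b c x = (x - b) * ((x + b) ^+ 2 - c ^+ 2 * x) / (x * (x + b)).
Proof. by move=> x0 xb0; rewrite /kfun; field; rewrite x0 xb0. Qed.

(** Beyond [b] the other factors in [kfun_factor] are positive. This inequality drives both the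
    monotonicity of [kfun] and the semidefiniteness of the eigenvector. *)
Lemma kfun_gt0_disc {R : realFieldType} (b c x : R) : 0 <= b -> b < x ->
  0 < kfun b c x -> c ^+ 2 * x < (x + b) ^+ 2.
Proof.
move=> b0 bx; have x0 : 0 < x by lra.
have xb0 : 0 < x + b by lra.
rewrite kfun_factor ?gt_eqF// => h.
have n0 : 0 < (x * (x + b))^-1 by rewrite invr_gt0 mulr_gt0.
by move: h; rewrite (pmulr_lgt0 _ n0) pmulr_rgt0 subr_gt0.
Qed.

(** The increment is a positive multiple of a positive term plus [2 b y] times the quadratic of
    [kfun_gt0_disc]. Without positivity of [kfun] at [x], monotonicity can fail when [c^2 > 4 b]. *)
Lemma kfun_lt {R : realFieldType} (b c x y : R) : 0 <= b -> b < x -> x < y ->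
  0 < kfun b c x -> kfun b c x < kfun b c y.
Proof.
move=> b0 bx xy /(kfun_gt0_disc _ _ _ b0 bx) disc; rewrite -subr_gt0.
have x0 : 0 < x by lra.
have y0 : 0 < y by lra.
have xb0 : 0 < x + b by lra.
have yb0 : 0 < y + b by lra.
have -> : kfun b c y - kfun b c x = (y - x) / (x * y * (x + b) * (y + b)) *
    ((y - b) * (x * y - b ^+ 2) * (x + b) +
     2 * b * y * ((x + b) ^+ 2 - c ^+ 2 * x)).
  by rewrite /kfun; field; rewrite !gt_eqF.
rewrite mulr_gt0 ?divr_gt0 ?subr_gt0 ?mulr_gt0//.
apply: ltr_pwDl; last by rewrite !mulr_ge0 ?subr_ge0// ltW.
rewrite !mulr_gt0 ?subr_gt0//; [lra|nra].
Qed.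

Lemma kfun_le_double {R : realFieldType} (b c x : R) : 0 <= b -> b < x ->
  kfun b c x <= 2 * (x - b).
Proof.
move=> b0 bx; have x0 : 0 < x by lra.
have xb0 : 0 < x + b by lra.
rewrite -subr_ge0.
have -> : 2 * (x - b) - kfun b c x =
   (x - b) ^+ 2 / x + c ^+ 2 * (x - b) / (x + b).
  by rewrite /kfun; field; rewrite !gt_eqF.
have [[x0' xb0'] bx'] := (ltW x0, ltW xb0, ltW bx).
by rewrite addr_ge0 ?(sqr_ge0, divr_ge0, mulr_ge0, subr_ge0).
Qed.

(** Used at the root of the secular equation, for the lower bound on the spectral radius. *)
Lemma kfun_le {R : realFieldType} (b c x : R) : 0 <= b -> b < x ->
  kfun b c x <= x.
Proof.
move=> b0 bx; have x0 : 0 < x by lra.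
have xb0 : 0 < x + b by lra.
rewrite /kfun.
have h1 : 0 <= b ^+ 2 / x by rewrite divr_ge0 ?sqr_ge0// ltW.
have h2 : 0 <= c ^+ 2 * (x - b) / (x + b).
  by rewrite ?(sqr_ge0, divr_ge0, mulr_ge0, subr_ge0)// ltW.
lra.
Qed.

Lemma kfun_ge {R : realFieldType} (b c x : R) : 0 <= b -> b < x ->
  x - b - c ^+ 2 <= kfun b c x.
Proof.
move=> b0 bx; have x0 : 0 < x by lra.
have xb0 : 0 < x + b by lra.
rewrite -subr_ge0.
have -> : kfun b c x - (x - b - c ^+ 2) =
   b * (x - b) / x + 2 * b * c ^+ 2 / (x + b).
  by rewrite /kfun; field; rewrite !gt_eqF.
have [[x0' xb0'] bx'] := (ltW x0, ltW xb0, ltW bx).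
by rewrite addr_ge0 ?(sqr_ge0, divr_ge0, mulr_ge0, subr_ge0).
Qed.

(** * Comparison of |k(z)| with k(|z|) *)

(* This is |k(z)| >= k(|z|) after clearing denominators and squaring, with
   C = cos (arg z), m = |z|^2 + b^2, B = 2 b |z| and s = (2 b - c^2) |z|.  The
   difference of the two sides is (1 - C) times a convex quadratic in s, whose
   vertex is g / (2 B): either g >= 2 B^2, so that it decreases up to s = B, where
   it is nonnegative, or its discriminant is nonpositive. *)
Lemma cmod_kfun_poly_ineq {R : realFieldType} (m B C s : R) :
  0 <= B -> B < m -> -1 <= C -> C <= 1 -> s <= B ->
  (m - B) * (m + B * C) * (m + s) ^+ 2 <=
  (m - B * C) * (m + B) * ((m + s * C) ^+ 2 + (s ^+ 2 - B ^+ 2) * (1 - C ^+ 2)).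
Proof.
move=> B0 Bm C1 C1' sB.
have m0 : 0 < m by lra.
pose g := m ^+ 2 - m * B * C - m * B - B ^+ 2 * C.
pose h := 2 * m * B * (m ^+ 2 - B ^+ 2 * (1 - C ^+ 2)) -
          (m - B) * (m + B * C) * B ^+ 2 * (1 + C).
pose E t := 2 * m * B * t ^+ 2 - 2 * m * g * t + h.
rewrite -subr_ge0.
have -> : (m - B * C) * (m + B) *
   ((m + s * C) ^+ 2 + (s ^+ 2 - B ^+ 2) * (1 - C ^+ 2)) -
   (m - B) * (m + B * C) * (m + s) ^+ 2 = (1 - C) * E s.
  by rewrite /E /g /h; ring.
apply: mulr_ge0; first lra.
have [gB|gB] := leP (2 * B ^+ 2) g.
  have EB : 0 <= E B.
    have -> : E B = B ^+ 2 * (m + B * C) * (1 + C) * (m + B).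
      by rewrite /E /g /h; ring.
    by rewrite !mulr_ge0 ?sqr_ge0//; nra.
  have -> : E s = E B + (B - s) * (2 * m * (g - B * (s + B))).
    by rewrite /E; ring.
  by rewrite addr_ge0 ?mulr_ge0 ?subr_ge0//; nra.
have Bp : 0 < B.
  rewrite lt_neqAle B0 andbT; apply/negP => /eqP B00; move: gB.
  by rewrite /g -B00; nra.
suff : 0 <= 2 * B * E s by rewrite pmulr_rge0 //; lra.
have -> : 2 * B * E s = m * (2 * B * s - g) ^+ 2 + (2 * B * h - m * g ^+ 2).
  by rewrite /E; ring.
apply: addr_ge0; first by rewrite mulr_ge0 ?sqr_ge0 ?ltW.
(* In these variables the case assumption [g < 2 B^2] yields [gE], and the quantity left to bound
   becomes a sum of products of nonnegative factors. *)
pose e := m - B; pose T := B * (1 - C).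
have e0 : 0 < e by rewrite /e; lra.
have T0 : 0 <= T by rewrite /T mulr_ge0//; lra.
have TB : 0 <= 2 * B - T by rewrite /T; nra.
have gE : 0 <= 2 * B * (2 * B - T) - e * (e + T).
  by move: gB; rewrite /g /e /T; lra.
have -> : 2 * B * h - m * g ^+ 2 =
  e * (2 * B * (2 * B - T) * (2 * B * T + e ^+ 2 + 2 * B * e + e * T) +
       (B + e) * (e + T) * (2 * B * (2 * B - T) - e * (e + T))).
  by rewrite /g /h /e /T; ring.
apply: mulr_ge0; first exact: ltW.
have e0' := ltW e0; clearbody e T.
move: (_ * (2 * B - T) - _) gE => x x0; move: (2 * B - T) TB => y y0.
by rewrite ?(sqr_ge0, addr_ge0, mulr_ge0).
Qed.

Lemma cmod_real {R : rcfType} (x : R) : 0 <= x -> cmod x%:C = x.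
Proof. by move=> x0; rewrite /cmod /= expr0n addr0 sqrtr_sqr ger0_norm. Qed.

Lemma cmod_ge0 {R : rcfType} (z : R[i]) : 0 <= cmod z.
Proof. by case: z => x y; exact: sqrtr_ge0. Qed.

Lemma lt_cmod_neq0 {R : rcfType} (b : R) (z : R[i]) :
  0 <= b -> b < cmod z -> z != 0 /\ z + b%:C != 0.
Proof.
move=> b0 bz; split; apply/eqP.
  by move=> z0; move: bz; rewrite z0 /cmod normc0 ltNge b0.
move/eqP; rewrite addr_eq0 => /eqP zb.
by move: bz; rewrite zb /cmod normcN -/(cmod _) cmod_real// ltxx.
Qed.

Lemma kfun_cmod {R : rcfType} (b c : R) (z : R[i]) : 0 <= b -> b < cmod z ->
  kfun b c (cmod z) <= cmod (kfun b%:C c%:C z).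
Proof.
move=> b0; case: z => x y; set z := x +i* y; set r := cmod z => br.
have r0 : 0 < r by lra.
have rE : r ^+ 2 = x ^+ 2 + y ^+ 2.
  by rewrite /r /cmod /= sqr_sqrtr ?addr_ge0 ?sqr_ge0.
have sqE (u v : R) : cmod (u +i* v) ^+ 2 = u ^+ 2 + v ^+ 2.
  by rewrite /cmod /= sqr_sqrtr ?addr_ge0 ?sqr_ge0.
have [z0 zb0] := lt_cmod_neq0 _ _ b0 br.
have [kr|kr] := leP (kfun b c r) 0; first exact: le_trans kr (cmod_ge0 _).
have disc := kfun_gt0_disc _ _ _ b0 br kr.
rewrite -(@ler_pXn2r _ 2) ?nnegrE ?cmod_ge0 ?(ltW kr)//.
have rb0 : 0 < r + b by lra.
rewrite (@kfun_factor R) ?gt_eqF// (@kfun_factor R[i])//.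
rewrite /cmod !(normcM, normcV) !exprMn !exprVn !exprMn -!/(cmod _) -/r.
have y2 : y ^+ 2 = r ^+ 2 - x ^+ 2 by rewrite rE; ring.
have -> : z - b%:C = (x - b) +i* y by rewrite /z; simpc.
have -> : z + b%:C = (x + b) +i* y by rewrite /z; simpc.
have -> : ((x + b) +i* y) ^+ 2 - c%:C ^+ 2 * z =
    ((x + b) ^+ 2 - y ^+ 2 - c ^+ 2 * x) +i* ((2 * (x + b) - c ^+ 2) * y).
  apply/eqP; rewrite /z !expr2 eq_complex /=.
  by apply/andP; split; apply/eqP; ring.
rewrite !sqE -?rE.
have xr : x ^+ 2 <= r ^+ 2 by rewrite rE lerDl sqr_ge0.
have C1 : -1 <= x / r by rewrite ler_pdivlMr//; nra.
have C1' : x / r <= 1 by rewrite ler_pdivrMr//; nra.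
have Bm : 2 * b * r < r ^+ 2 + b ^+ 2 by nra.
have sB : r * (2 * b - c ^+ 2) <= 2 * b * r.
  by have := mulr_ge0 (ltW r0) (sqr_ge0 c); lra.
have B0 : 0 <= 2 * b * r by rewrite !mulr_ge0// ltW.
(* With [C = x / r], the factors on the right are the squared moduli of [z - b], [z + b] and
   [(z + b)^2 - c^2 z]; those on the left hold the corresponding values at [r]. *)
have := cmod_kfun_poly_ineq _ _ _ _ B0 Bm C1 C1' sB.
have -> : (r ^+ 2 + b ^+ 2 + r * (2 * b - c ^+ 2) * (x / r)) ^+ 2 +
  ((r * (2 * b - c ^+ 2)) ^+ 2 - (2 * b * r) ^+ 2) * (1 - (x / r) ^+ 2) =
  ((x + b) ^+ 2 - y ^+ 2 - c ^+ 2 * x) ^+ 2 + ((2 * (x + b) - c ^+ 2) * y) ^+ 2.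
  by rewrite [in RHS]exprMn y2; field; rewrite gt_eqF.
have -> : r ^+ 2 + b ^+ 2 + 2 * b * r * (x / r) = (x + b) ^+ 2 + y ^+ 2.
  by rewrite y2; field; rewrite gt_eqF.
have -> : r ^+ 2 + b ^+ 2 - 2 * b * r * (x / r) = (x - b) ^+ 2 + y ^+ 2.
  by rewrite y2; field; rewrite gt_eqF.
have n3 : 0 < (x + b) ^+ 2 + y ^+ 2 by rewrite y2; nra.
move: (_ ^+ 2 + ((2 * (x + b) - c ^+ 2) * y) ^+ 2) => N2 core.
have d1 : 0 < r ^+ 2 * ((x + b) ^+ 2 + y ^+ 2).
  exact: mulr_gt0 (exprn_gt0 _ r0) n3.
have d2 : 0 < r ^+ 2 * (r + b) ^+ 2 by rewrite mulr_gt0 ?exprn_gt0.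
rewrite (ler_pdivlMr _ _ d1) [leLHS]mulrAC (ler_pdivrMr _ _ d2).
rewrite -subr_ge0; move: core; rewrite -subr_ge0 => core.
have := mulr_ge0 (sqr_ge0 r) core; congr (_ <= _); ring.
Qed.

(** * The eigenvalue equation in scalar coordinates, and invariance of the cone *)

Lemma mx2P {K : nzRingType} (A B : 'M[K]_2) :
  A 0 0 = B 0 0 -> A 0 1 = B 0 1 -> A 1 0 = B 1 0 -> A 1 1 = B 1 1 -> A = B.
Proof.
move=> e00 e01 e10 e11; apply/matrixP => i j.
have ord2 (k : 'I_2) : k = 0 \/ k = 1.
  by case: k => [[|[|//]] k2]; [left|right]; apply: val_inj.
by case: (ord2 i) => ->; case: (ord2 j) => ->.
Qed.

Lemma mulmx2E {K : nzRingType} m n (A : 'M[K]_(m, 2)) (B : 'M[K]_(2, n)) i j :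
  (A *m B) i j = A i 0 * B 0 j + A i 1 * B 1 j.
Proof.
rewrite mxE big_ord_recl big_ord1; congr (_ + A i _ * B _ j); exact: val_inj.
Qed.

Lemma sym2E {K : nzRingType} (W : 'M[K]_2) : sym2 W <-> W 1 0 = W 0 1.
Proof.
split=> [sW|W10]; first by rewrite -{1}sW mxE.
by apply: mx2P; rewrite mxE ?W10.
Qed.

Lemma quad2E {K : comNzRingType} (W : 'M[K]_2) (x : 'cV[K]_2) : sym2 W ->
  (x^T *m W *m x) 0 0 =
  x 0 0 ^+ 2 * W 0 0 + 2 * x 0 0 * x 1 0 * W 0 1 + x 1 0 ^+ 2 * W 1 1.
Proof. by move/sym2E => W10; rewrite !mulmx2E !mxE W10; ring. Qed.

(** The coordinates (p, q, r) of [Qmx] are (1, 0, 0), so the terms along [Qmx], including the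
    coupling sum, enter the first equation only. *)
Lemma Tadam_eigE {K : fieldType} (d : nat) (eta b : K) (lam sig : 'I_d -> K)
    (W : 'I_d -> 'M[K]_2) (i : 'I_d) (z : K) : sym2 (W i) ->
  let a := (1 - b) * eta * lam i in let c := 1 + b - a in
  let p := W i 0 0 in let q := p + W i 0 1 in
  let r := p + 2 * W i 0 1 + W i 1 1 in
  Tadam eta b lam sig W i = z *: W i <->
  [/\ z * p = (c ^+ 2 + a ^+ 2) * p - 2 * b * c * q + b ^+ 2 * r +
              (sig i)^-1 * (((1 - b) * eta) ^+ 2 *
                            \sum_j sig j * lam j ^+ 2 * W j 0 0),
      z * q = c * p - b * q & z * r = p].
Proof.
move=> /sym2E W10 a c p q r; rewrite /Tadam.
move: (\sum_j _) => F.
have E j k : ((z *: W i) : 'M_2) j k = z * W i j k by rewrite mxE.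
set T := (X in X = _).
have T00 : T 0 0 = (1 - a) ^+ 2 * p - 2 * b * (1 - a) * W i 0 1 +
   b ^+ 2 * W i 1 1 + a ^+ 2 * p + (sig i)^-1 * (((1 - b) * eta) ^+ 2 * F).
  by rewrite /T /p mxE !mulmx2E !mxE /= W10 /a; ring.
have T01 : T 0 1 = (1 - a) * a * p + b * (1 - 2 * a) * W i 0 1 -
   b ^+ 2 * W i 1 1 - a ^+ 2 * p - (sig i)^-1 * (((1 - b) * eta) ^+ 2 * F).
  by rewrite /T /p mxE !mulmx2E !mxE /= W10 /a; ring.
have T10 : T 1 0 = (1 - a) * a * p + b * (1 - 2 * a) * W i 0 1 -
   b ^+ 2 * W i 1 1 - a ^+ 2 * p - (sig i)^-1 * (((1 - b) * eta) ^+ 2 * F).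
  by rewrite /T /p mxE !mulmx2E !mxE /= W10 /a; ring.
have T11 : T 1 1 = a ^+ 2 * p + 2 * a * b * W i 0 1 +
   b ^+ 2 * W i 1 1 + a ^+ 2 * p + (sig i)^-1 * (((1 - b) * eta) ^+ 2 * F).
  by rewrite /T /p mxE !mulmx2E !mxE /= W10 /a; ring.
split=> [TE|[e1 e2 e3]].
  move: T00 T01 T11; rewrite TE !E -/p => e00 e01 e11.
  have zq : z * q = z * p + z * W i 0 1 by rewrite /q; ring.
  have zr : z * r = z * p + 2 * (z * W i 0 1) + z * W i 1 1 by rewrite /r; ring.
  by rewrite zq zr e00 e01 e11 /c /q /r; split; ring.
have y : W i 0 1 = q - p by rewrite /q; ring.
have w : W i 1 1 = r - 2 * q + p by rewrite /q /r; ring.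
have e01 : T 0 1 = z * W i 0 1.
  by rewrite y mulrBr e1 e2 T01 y w /c; ring.
apply: mx2P; rewrite E ?W10 //.
- by rewrite T00 -/p e1 y w /c; ring.
- by rewrite -e01 T10 T01.
- have -> : z * W i 1 1 = z * r - 2 * (z * q) + z * p by rewrite w; ring.
  by rewrite T11 e1 e2 e3 y w /c; ring.
Qed.

Lemma psd2_diag0 {R : realFieldType} (W : 'M[R]_2) : psd2 W -> 0 <= W 0 0.
Proof.
case=> sW /(_ (\col_i (i == 0)%:R)); rewrite quad2E// !mxE /=.
by rewrite expr1n expr0n /= !mulr0 !mul0r !addr0 mul1r.
Qed.

Lemma Qmx_psd (R : realFieldType) : psd2 (Qmx : 'M[R]_2).
Proof.
have sQ : sym2 (Qmx : 'M[R]_2) by apply/sym2E; rewrite !mxE.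
split=> // x; rewrite quad2E// !mxE /=.
by have := sqr_ge0 (x 0 0 - x 1 0); congr (_ <= _); ring.
Qed.

Lemma Tadam_inK {R : realFieldType} (d : nat) (eta b : R) (lam sig : 'I_d -> R)
    (W : 'I_d -> 'M[R]_2) :
  (forall i, 0 < sig i) -> inK W -> inK (Tadam eta b lam sig W).
Proof.
move=> sig0 KW i; rewrite /Tadam; set A := Amx _ _ _; set k := (_ * (_ + _)).
have k0 : 0 <= k.
  have pi j : 0 <= lam j ^+ 2 * W j 0 0.
    by rewrite mulr_ge0 ?sqr_ge0// psd2_diag0.
  rewrite mulr_ge0 ?sqr_ge0// addr_ge0// mulr_ge0 ?invr_ge0 ?(ltW (sig0 i))//.
  by apply: sumr_ge0 => j _; rewrite -mulrA mulr_ge0// ltW.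
have [sW pW] := KW i; have [sQ pQ] := Qmx_psd R.
split; first by rewrite /sym2 linearD linearZ /= sQ !trmx_mul trmxK sW mulmxA.
move=> x; rewrite mulmxDr mulmxDl -scalemxAr -scalemxAl [leRHS]mxE addr_ge0//.
  have := pW (A^T *m x); rewrite trmx_mul trmxK !mulmxA; exact.
by rewrite mxE mulr_ge0.
Qed.

(** * The secular equation and its real root *)

Definition secular {R : fieldType} {d : nat} (b : R) (a c : 'I_d -> R) (x : R) : R :=
  \sum_i a i ^+ 2 / (kfun b (c i) x - a i ^+ 2).

(** Intermediate value theorem for the polynomial [x (x + b) (kfun b c x - v)]; [kfun_le_double] and
    [kfun_ge] give its signs at the two endpoints. *)
Lemma kfun_surj {R : rcfType} (b c v : R) : 0 <= b -> 0 < v ->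
  exists2 x, b < x & kfun b c x = v.
Proof.
move=> b0 v0; pose p : {poly R} :=
  ('X - b%:P) * (('X + b%:P) ^+ 2 - c ^+ 2 *: 'X) - v *: ('X * ('X + b%:P)).
have pE x : b < x -> p.[x] = x * (x + b) * (kfun b c x - v).
  move=> bx; rewrite kfun_factor ?gt_eqF; try lra.
  by rewrite /p !hornerE /=; field; rewrite !gt_eqF; lra.
have c0 := sqr_ge0 c.
have l0 : b < b + v / 2 by lra.
have r0 : b < b + c ^+ 2 + v by lra.
have g0 x : b < x -> 0 < x * (x + b) by move=> bx; rewrite mulr_gt0//; lra.
have [| |x /andP[lx xr] /rootP] := @poly_ivt R p (b + v / 2) (b + c ^+ 2 + v).
- lra.
- rewrite !pE// pmulr_rle0 ?g0// pmulr_rge0 ?g0//.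
  by have := kfun_le_double _ c _ b0 l0; have := kfun_ge _ c _ b0 r0; lra.
have bx : b < x by lra.
rewrite pE// => /eqP; rewrite mulf_eq0 gt_eqF ?g0//= subr_eq0 => /eqP kx.
by exists x.
Qed.

Lemma secular_lt {R : realFieldType} {d : nat} (b : R) (a c : 'I_d -> R) (x y : R) :
  (0 < d)%N -> 0 <= b -> b < x -> x < y -> (forall i, 0 < a i) ->
  (forall i, a i ^+ 2 < kfun b (c i) x) ->
  (forall i, a i ^+ 2 < kfun b (c i) y) /\ secular b a c y < secular b a c x.
Proof.
move=> d0 b0 bx xy a0 kx.
have kxy i : kfun b (c i) x < kfun b (c i) y.
  by apply: kfun_lt => //; apply: lt_trans (kx i); rewrite exprn_gt0.
split=> [i|]; first exact: lt_trans (kxy i).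
apply: ltr_sum; first by apply/hasP; exists (Ordinal d0); rewrite ?mem_index_enum.
move=> i _; rewrite ltr_pM2l ?exprn_gt0// ltf_pV2 ?posrE ?subr_gt0//.
  by rewrite ltrD2r.
exact: lt_trans (kxy i).
Qed.

Lemma secular_root {R : rcfType} {d : nat} (b : R) (a c : 'I_d -> R) :
  (0 < d)%N -> 0 <= b -> (forall i, 0 < a i) ->
  exists x, [/\ b < x, forall i, a i ^+ 2 < kfun b (c i) x &
                secular b a c x = 1].
Proof.
move=> d0 b0 a0.
have a20 i : 0 < a i ^+ 2 by rewrite exprn_gt0.
(* At [u i] the summand of index i equals 1. From the largest such point [x1] onwards all
   denominators are positive, and the sum at [x1] is at least 1. *)
have /fin_all_exists2[u bu ku] :
    forall i, exists2 x, b < x & kfun b (c i) x = 2 * a i ^+ 2.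
  by move=> i; apply: kfun_surj; rewrite ?mulr_gt0.
have [i0 _ /= i0max] := @Order.TotalTheory.arg_maxP _ _ _ (Ordinal d0) predT u isT.
pose x1 := u i0.
have bx1 : b < x1 by exact: bu.
have kx1 x i : x1 <= x -> 2 * a i ^+ 2 <= kfun b (c i) x.
  move=> x1x; have : u i <= x by apply: le_trans x1x; exact: i0max.
  rewrite le_eqVlt => /orP[/eqP <-|ux]; first by rewrite ku.
  by rewrite -ku ltW// kfun_lt// ku mulr_gt0.
(* Far enough, by [kfun_ge], for every summand to be at most 1/d. *)
pose x2 := x1 + \sum_i (c i ^+ 2 + (1 + d%:R) * a i ^+ 2).
have t0 i : 0 <= c i ^+ 2 + (1 + d%:R) * a i ^+ 2.
  by rewrite addr_ge0 ?sqr_ge0// mulr_ge0 ?addr_ge0 ?ler0n// ltW.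
have x12 : x1 <= x2 by rewrite lerDl sumr_ge0.
have kx2 i : (1 + d%:R) * a i ^+ 2 <= kfun b (c i) x2.
  have bx2 : b < x2 by exact: lt_le_trans x12.
  have : c i ^+ 2 + (1 + d%:R) * a i ^+ 2 <= x2 - x1.
    by rewrite /x2 addrAC subrr add0r (bigD1 i)//= lerDl sumr_ge0.
  by have := kfun_ge _ (c i) _ b0 bx2; lra.
(* The summand of i0 alone is 1 at x1. *)
have F1 : 1 <= secular b a c x1.
  rewrite /secular (bigD1 i0)//= ku.
  have -> : 2 * a i0 ^+ 2 - a i0 ^+ 2 = a i0 ^+ 2 by ring.
  rewrite divff ?gt_eqF// lerDl sumr_ge0// => i _.
  rewrite divr_ge0 ?sqr_ge0// subr_ge0.
  by have := kx1 x1 i (lexx _); have := a20 i; lra.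
have F2 : secular b a c x2 <= 1.
  have -> : 1 = \sum_(i < d) (d%:R : R)^-1.
    by rewrite sumr_const card_ord -[_ *+ d]mulr_natl divff// pnatr_eq0 -lt0n.
  apply: ler_sum => i _; have k2 := kx2 i; have ai := a20 i.
  have dp : 0 < d%:R :> R by rewrite ltr0n.
  have : d%:R * a i ^+ 2 <= kfun b (c i) x2 - a i ^+ 2 by lra.
  move: (kfun _ _ _ - _) => k dk.
  have k0 : 0 < k by apply: lt_le_trans dk; rewrite mulr_gt0.
  by rewrite ler_pdivrMr// ler_pdivlMl.
pose g : {poly R} := 'X * ('X + b%:P).
pose N i : {poly R} := ('X - b%:P) * (('X + b%:P) ^+ 2 - c i ^+ 2 *: 'X) - a i ^+ 2 *: g.
(* p = (prod_i N_i) (1 - secular) with denominators cleared *)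
pose p := \prod_i N i - \sum_i a i ^+ 2 *: g * \prod_(j | j != i) N j.
have NE x i : x1 <= x ->
    (N i).[x] = x * (x + b) * (kfun b (c i) x - a i ^+ 2).
  move=> x1x; rewrite kfun_factor ?gt_eqF; try lra.
  by rewrite /N /g !hornerE /=; field; rewrite !gt_eqF; lra.
have f0 x i : x1 <= x -> 0 < kfun b (c i) x - a i ^+ 2.
  by move=> x1x; have := kx1 x i x1x; have := a20 i; lra.
have pE x : x1 <= x -> p.[x] = (\prod_i (N i).[x]) * (1 - secular b a c x).
  move=> x1x; rewrite /p hornerD hornerN horner_prod horner_sum mulrBr mulr1.
  congr (_ - _); rewrite /secular mulr_sumr; apply: eq_bigr => i _.
  rewrite [in RHS](bigD1 i)//= hornerM horner_prod hornerZ /g NE// !hornerE /=.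
  by field; rewrite gt_eqF// f0.
have P0 x : x1 <= x -> 0 < \prod_i (N i).[x].
  move=> x1x; apply: prodr_gt0 => i _; rewrite NE// mulr_gt0 ?f0//.
  by rewrite mulr_gt0//; lra.
have [|x /andP[lx xr] /rootP] := @poly_ivt R p _ _ x12.
  by rewrite !pE// pmulr_rle0 ?P0// pmulr_rge0 ?P0// subr_le0 subr_ge0 F1.
rewrite pE// => /eqP; rewrite mulf_eq0 gt_eqF ?P0//= subr_eq0 => /eqP Fx.
exists x; split=> //; first exact: lt_le_trans lx.
by move=> i; rewrite -subr_gt0 f0.
Qed.

(** * Upper bound on the moduli of complex eigenvalues *)

Lemma recurrence_reduced {K : fieldType} (a b c z p q r X : K) :
  z != 0 -> z + b != 0 ->
  [/\ z * p = (c ^+ 2 + a ^+ 2) * p - 2 * b * c * q + b ^+ 2 * r + X,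
      z * q = c * p - b * q & z * r = p] <->
  [/\ p * (kfun b c z - a ^+ 2) = X, q = c * p / (z + b) & r = p / z].
Proof.
move=> z0 zb0; split=> [[e1 e2 e3]|[<- -> ->]].
  have qE : q = c * p / (z + b).
    by apply: (mulIf zb0); rewrite divfK// mulrDr mulrC e2; ring.
  have rE : r = p / z by rewrite -e3 mulrC mulKf.
  split=> //; have -> : X = z * p -
    ((c ^+ 2 + a ^+ 2) * p - 2 * b * c * q + b ^+ 2 * r) by rewrite e1; ring.
  by rewrite qE rE /kfun; field; rewrite z0 zb0.
by rewrite /kfun; split; field; rewrite ?z0 ?zb0.
Qed.

(** Carries a real eigenvector to the complexification. *)
Lemma map_Tadam {K L : fieldType} (f : {rmorphism K -> L}) (d : nat) (eta b : K)
    (lam sig : 'I_d -> K) (W : 'I_d -> 'M[K]_2) (i : 'I_d) :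
  Tadam (f eta) (f b) (f \o lam) (f \o sig) (fun j => map_mx f (W j)) i =
  map_mx f (Tadam eta b lam sig W i).
Proof.
have mapA e l : map_mx f (Amx e b l) = Amx (f e) (f b) (f l).
  by apply: mx2P; rewrite !mxE /= ?(rmorphB, rmorphN, rmorphM, rmorph1).
have mapQ : map_mx f Qmx = Qmx by apply: mx2P; rewrite !mxE /= ?(rmorphN, rmorph1).
rewrite /Tadam map_mxD map_mxZ !map_mxM -map_trmx mapA mapQ /=.
have -> : f ((1 - b) * eta) = (1 - f b) * f eta by rewrite rmorphM rmorphB rmorph1.
congr (_ + _ *: _); rewrite rmorphM rmorphXn rmorphM rmorphB rmorph1.
congr (_ * _); rewrite rmorphD rmorphM rmorphXn rmorphM fmorphV mxE.
congr (_ + _ * _); rewrite rmorph_sum; apply: eq_bigr => j _.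
by rewrite rmorphM rmorphM rmorphXn mxE.
Qed.

(** Let F be the secular function and Phi the coupling sum. Bounding each |p_i| by |Phi| and summing
    gives |Phi| <= F(|z|) |Phi|. As F(|z|) < F(x) = 1, Phi vanishes, and then so does every p_i. *)
Lemma secular_cmod_le {R : rcfType} (d : nat) (b x : R) (a c s : 'I_d -> R)
    (p : 'I_d -> R[i]) (z : R[i]) :
  (0 < d)%N -> 0 <= b -> b < x -> (forall i, 0 < a i) -> (forall i, 0 < s i) ->
  (forall i, a i ^+ 2 < kfun b (c i) x) -> secular b a c x = 1 ->
  (forall i, p i * (kfun b%:C (c i)%:C z - (a i)%:C ^+ 2) =
             (s i)%:C^-1 * \sum_j (s j * a j ^+ 2)%:C * p j) ->
  x < cmod z -> forall i, p i = 0.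
Proof.
move=> d0 b0 bx a0 s0 kx Fx pE xr.
set r := cmod z in xr; have br : b < r by exact: lt_trans xr.
have [kr Fr] := secular_lt _ _ _ _ _ d0 b0 bx xr a0 kx.
rewrite Fx in Fr.
set Phi := \sum_j _ in pE.
have f0 i : 0 < kfun b (c i) r - a i ^+ 2 by rewrite subr_gt0.
have pk i : cmod (p i) * (kfun b (c i) r - a i ^+ 2) <= (s i)^-1 * cmod Phi.
  have -> : (s i)^-1 * cmod Phi = cmod ((s i)%:C^-1 * Phi).
    by rewrite /cmod normcM normcV -/(cmod (s i)%:C) cmod_real// ltW.
  rewrite -pE /cmod normcM ler_wpM2l ?cmod_ge0// lerBlDr.
  apply: le_trans (kfun_cmod _ (c i) _ b0 br) _.
  (* Triangle inequality: |k| <= |k - a^2| + a^2. *)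
  rewrite -[X in cmod X](subrK ((a i)%:C ^+ 2)).
  apply: le_trans (le_normcD _ _) _; rewrite lerD2l -rmorphXn.
  by rewrite -/(cmod _) cmod_real ?sqr_ge0.
have Phi_le : cmod Phi <= secular b a c r * cmod Phi.
  have le1 : cmod Phi <= \sum_j s j * a j ^+ 2 * cmod (p j).
    apply: (big_ind2 (fun u v => cmod u <= v)).
    - by rewrite /cmod normc0.
    - by move=> u1 v1 u2 v2 h1 h2; apply: le_trans (le_normcD _ _) _; apply: lerD.
    - move=> j _; rewrite /cmod normcM -!/(cmod _) cmod_real//.
      by rewrite mulr_ge0 ?sqr_ge0// ltW.
  apply: le_trans le1 _; rewrite mulr_suml; apply: ler_sum => j _.
  have := pk j; rewrite mulrC -ler_pdivlMl// => h.
  have sa : 0 <= s j * a j ^+ 2 by rewrite mulr_ge0 ?sqr_ge0// ltW.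
  apply: le_trans (ler_wpM2l sa h) _; rewrite le_eqVlt; apply/orP; left.
  by apply/eqP; field; rewrite !gt_eqF.
have Phi0 : cmod Phi = 0.
  by apply/eqP; rewrite eq_le cmod_ge0 andbT; have := cmod_ge0 Phi; nra.
move=> i; apply: eq0_normc; apply/eqP; rewrite eq_le cmod_ge0 andbT.
by have := pk i; rewrite Phi0 mulr0 pmulr_lle0.
Qed.

Lemma Tadam_eigenvalue_le {R : realType} (d : nat) (eta b x : R)
    (lam sig : 'I_d -> R) (z : R[i]) :
  let a i := (1 - b) * eta * lam i in let c i := 1 + b - a i in
  (0 < d)%N -> 0 <= b -> b < x -> (forall i, 0 < a i) -> (forall i, 0 < sig i) ->
  (forall i, a i ^+ 2 < kfun b (c i) x) -> secular b a c x = 1 ->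
  Tadam_eigenvalue eta b lam sig z -> cmod z <= x.
Proof.
move=> a c d0 b0 bx a0 s0 kx Fx [W [sW [[i Wi0] TW]]].
rewrite leNgt; apply/negP => xr.
have br : b < cmod z by exact: lt_trans xr.
have [z0 zb0] := lt_cmod_neq0 _ _ b0 br.
have aE j : (1 - b%:C) * eta%:C * (lam j)%:C = (a j)%:C.
  by rewrite !rmorphM rmorphB rmorph1.
have cE j : 1 + b%:C - (a j)%:C = (c j)%:C.
  by rewrite rmorphB rmorphD rmorph1.
have eqs j := (recurrence_reduced _ _ _ _ _ _ _ _ z0 zb0).1
  ((Tadam_eigE _ _ _ _ _ _ _ _ (sW j)).1 (TW j)).
have p0 : forall j, W j 0 0 = 0.
  apply: (secular_cmod_le _ b x a c sig _ z) => // j.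
  have [+ _ _] := eqs j; rewrite !aE !cE => ->; congr (_ * _).
  rewrite mulr_sumr; apply: eq_bigr => k _.
  by rewrite !(rmorphM, rmorphXn, rmorphB, rmorph1); ring.
(* With p_i = 0 the reduced equations give q_i = r_i = 0, hence W_i = 0. *)
have [_ q0 r0] := eqs i.
move: q0 r0; rewrite p0 mulr0 !mul0r !add0r => q0; rewrite q0 mulr0 add0r => r0.
case/eqP: Wi0; apply: mx2P; rewrite mxE ?p0//.
by rewrite (sym2E _).1.
Qed.

(** * The explicit eigenvector *)

(* p is scaled so that the coupling sum et^2 sum_j sig_j lam_j^2 p_j equals 1. *)
Definition adam_eigvec {K : fieldType} {d : nat} (b z : K) (a c s : 'I_d -> K)
    (i : 'I_d) : 'M[K]_2 :=
  let p := (s i * (kfun b (c i) z - a i ^+ 2))^-1 in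
  let q := c i * p / (z + b) in
  \matrix_(j < 2, k < 2)
    (if j == 0 then (if k == 0 then p else q - p)
               else (if k == 0 then q - p else p / z - 2 * q + p)).

Lemma adam_eigvec_sym {K : fieldType} {d : nat} (b z : K) (a c s : 'I_d -> K) i :
  sym2 (adam_eigvec b z a c s i).
Proof. by apply/sym2E; rewrite !mxE. Qed.

(** Completing the square leaves a remainder with the sign of [(x + b)^2 - c^2 x], positive by
    [kfun_gt0_disc]. *)
Lemma adam_eigvec_psd {R : realFieldType} {d : nat} (b x : R)
    (a c s : 'I_d -> R) i :
  0 <= b -> b < x -> 0 < a i -> 0 < s i -> a i ^+ 2 < kfun b (c i) x ->
  psd2 (adam_eigvec b x a c s i).
Proof.
move=> b0 bx a0 s0 kx; split; first exact: adam_eigvec_sym.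
move=> v; rewrite quad2E; last exact: adam_eigvec_sym.
rewrite !mxE /=; set p := (_ * _)^-1.
have p0 : 0 < p by rewrite invr_gt0 mulr_gt0// subr_gt0.
have disc : c i ^+ 2 * x < (x + b) ^+ 2.
  by apply: kfun_gt0_disc => //; apply: lt_trans kx; rewrite exprn_gt0.
have x0 : 0 < x by lra.
have xb0 : 0 < x + b by lra.
have -> : v 0 0 ^+ 2 * p + 2 * v 0 0 * v 1 0 * (c i * p / (x + b) - p) +
    v 1 0 ^+ 2 * (p / x - 2 * (c i * p / (x + b)) + p) =
  p * ((v 0 0 - v 1 0 + v 1 0 * c i / (x + b)) ^+ 2 +
       v 1 0 ^+ 2 * ((x + b) ^+ 2 - c i ^+ 2 * x) / (x * (x + b) ^+ 2)).
  by field; rewrite !gt_eqF.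
rewrite mulr_ge0 ?(ltW p0)// addr_ge0 ?sqr_ge0//.
have [x0' disc'] := (ltW x0, ltW disc).
by rewrite ?(sqr_ge0, divr_ge0, mulr_ge0, subr_ge0).
Qed.

(** The secular equation is the consistency condition that the coupling sum of the scaled vector be
    1. *)
Lemma Tadam_adam_eigvec {K : fieldType} {d : nat} (eta b z : K)
    (lam sig : 'I_d -> K) :
  let a i := (1 - b) * eta * lam i in let c i := 1 + b - a i in
  z != 0 -> z + b != 0 -> (forall i, sig i != 0) ->
  (forall i, kfun b (c i) z - a i ^+ 2 != 0) -> secular b a c z = 1 ->
  forall i, Tadam eta b lam sig (adam_eigvec b z a c sig) i =
            z *: adam_eigvec b z a c sig i.
Proof.
move=> a c z0 zb0 s0 k0 Fz i.
apply/Tadam_eigE; first exact: adam_eigvec_sym.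
apply/(recurrence_reduced _ _ _ _ _ _ _ _ z0 zb0).
have -> : ((1 - b) * eta) ^+ 2 *
    (\sum_j sig j * lam j ^+ 2 * adam_eigvec b z a c sig j 0 0) = 1.
  rewrite -[RHS]Fz mulr_sumr; apply: eq_bigr => j _; rewrite !mxE /=.
  move: (kfun b (c j) z - a j ^+ 2) (k0 j) => k kn0.
  by rewrite /a; field; rewrite kn0 s0.
rewrite !mxE /= -/(a i) -/(c i); have := k0 i.
move: (kfun _ _ _ - _) => k kn0.
by split; [field; rewrite kn0 s0|ring|ring].
Qed.

(** * Values at 1 and the spectral radius *)

Lemma sup_max {R : realType} (E : set R) (x : R) :
  E x -> (forall y, E y -> y <= x) -> sup E = x.
Proof.
move=> Ex ubE; apply/eqP; rewrite eq_le; apply/andP; split.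
  by apply: ge_sup; [exists x|].
by apply: ub_le_sup => //; exists x.
Qed.

Lemma kfun_at1 {R : realFieldType} (eta b l : R) : 0 <= b ->
  let a := (1 - b) * eta * l in
  kfun b (1 + b - a) 1 - a ^+ 2 = 2 * a * (1 - b) * (1 - eta * l / (1 + b)).
Proof. by move=> b0 a; rewrite /kfun /a; field; rewrite gt_eqF; lra. Qed.

Lemma secular_at1 {R : realFieldType} {d : nat} (eta b : R) (lam : 'I_d -> R) :
  let a i := (1 - b) * eta * lam i in let c i := 1 + b - a i in
  0 <= b -> (forall i, 0 < a i) -> (forall i, eta * lam i < 1 + b) ->
  secular b a c 1 = S_adam eta b lam.
Proof.
move=> a c b0 a0 small; apply: eq_bigr => i _; rewrite kfun_at1//.
have t0 : 1 + b - eta * lam i != 0 by rewrite gt_eqF// subr_gt0.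
have := a0 i; rewrite /a => /lt0r_neq0.
rewrite !mulf_eq0 !negb_or => /andP[/andP[b1 e0] l0].
have b2 : 1 + b != 0 by rewrite gt_eqF//; lra.
by field; rewrite b1 e0 l0 b2 t0.
Qed.

Theorem theoremA5 (R : realType) (d : nat) (hd : (0 < d)%N)
    (P H U S : 'M[R]_d) (lam sig : 'I_d -> R) (eta b1 : R)
    (* P > 0, H >= 0 symmetric, commuting *)
    (hPsym : P^T = P) (hHsym : H^T = H)
    (hPpd : forall v : 'rV[R]_d, v != 0 -> 0 < (v *m P *m v^T) 0 0)
    (hHpsd : forall v : 'rV[R]_d, 0 <= (v *m H *m v^T) 0 0)
    (hPH : P *m H = H *m P)
    (* lam_1 >= ... >= lam_d > 0 are the eigenvalues of P^-1 H *)
    (hlam_eig : char_poly (invmx P *m H) = \prod_(i < d) ('X - (lam i)%:P))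
    (hlam_sorted : forall i j : 'I_d, (i <= j)%N -> lam j <= lam i)
    (hlam_pos : forall i, 0 < lam i)
    (* eta > 0, beta1 in [0,1) *)
    (heta : 0 < eta) (hb1 : 0 <= b1) (hb1' : b1 < 1)
    (* sigma_i > 0; orthonormal basis U diagonalizing P and P^-1/2 H P^-1/2,
       where S = P^-1/2 is the symmetric positive definite square root of P^-1 *)
    (hsig : forall i, 0 < sig i)
    (hU : U *m U^T = 1%:M)
    (hSsym : S^T = S)
    (hSpd : forall v : 'rV[R]_d, v != 0 -> 0 < (v *m S *m v^T) 0 0)
    (hS : S *m S = invmx P)
    (hUP : U *m P *m U^T = diag_mx (\row_i sig i))
    (hUH : U *m (S *m H *m S) *m U^T = diag_mx (\row_i lam i)) :
  let et := (1 - b1) * eta in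
  let rho := rho_adam eta b1 lam sig in
  let lam1 := lam (Ordinal hd) in
  (* (a) *)
  ((forall W : 'I_d -> 'M[R]_2, inK W -> inK (Tadam eta b1 lam sig W)) /\
   Tadam_eigenvalue eta b1 lam sig (rho%:C) /\
   (exists Wst : 'I_d -> 'M[R]_2,
      inK Wst /\ nonzeroX Wst /\
      (forall i, Tadam eta b1 lam sig Wst i = rho *: Wst i) /\
      0 < \sum_(i < d) Wst i 0 0) /\
   et ^+ 2 * (\sum_(i < d) lam i ^+ 2) <= rho /\
   0 < et ^+ 2 * (\sum_(i < d) lam i ^+ 2)) /\
  (* (b) *)
  (rho = 1 <-> (eta * lam1 < 1 + b1 /\ S_adam eta b1 lam = 1)) /\
  (* (c) *)
  (rho < 1 <-> (eta * lam1 < 1 + b1 /\ S_adam eta b1 lam < 1)).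
Proof.
move=> et rho lam1.
pose a i := (1 - b1) * eta * lam i; pose c i := 1 + b1 - a i.
have a0 i : 0 < a i by rewrite /a !mulr_gt0// subr_gt0.
have [x [bx kx Fx]] := secular_root b1 a c hd hb1 a0.
have x0 : 0 < x by lra.
pose W := adam_eigvec b1 x a c sig.
have f0 i : 0 < kfun b1 (c i) x - a i ^+ 2 by rewrite subr_gt0.
have TW i : Tadam eta b1 lam sig W i = x *: W i.
  by apply: Tadam_adam_eigvec => // [||j|j]; rewrite gt_eqF// ?f0//; lra.
have W0 i : 0 < W i 0 0 by rewrite mxE /= invr_gt0 mulr_gt0.
have nzW : nonzeroX W.
  exists (Ordinal hd); apply/eqP => Wz.
  by have := W0 (Ordinal hd); rewrite Wz mxE ltxx.
have eigx : Tadam_eigenvalue eta b1 lam sig x%:C.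
  exists (fun i => map_mx (real_complex R) (W i)); split.
    by move=> i; apply/sym2E; rewrite !mxE.
  split.
    have [i Wi] := nzW; exists i; apply: contra Wi => /eqP Wi.
    by rewrite -(map_mx_eq0 (real_complex R)) Wi.
  by move=> i; rewrite map_Tadam TW map_mxZ.
have rhoE : rho = x.
  apply: sup_max; first by exists x%:C => //; apply: cmod_real; exact: ltW.
  by move=> _ [z zE <-]; apply: Tadam_eigenvalue_le zE => //; exact: Fx.
have sum_a2 : et ^+ 2 * (\sum_(i < d) lam i ^+ 2) = \sum_(i < d) a i ^+ 2.
  by rewrite mulr_sumr; apply: eq_bigr => i _; rewrite /a -exprMn.
have lam_max i : lam i <= lam1 by apply: hlam_sorted.
have pos1 : eta * lam1 < 1 + b1 -> forall i, eta * lam i < 1 + b1.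
  by move=> h i; apply: le_lt_trans h; rewrite ler_pM2l.
(* The point 1 lies in the domain where [secular] decreases exactly under the stability
   condition. *)
have f1 i : (a i ^+ 2 < kfun b1 (c i) 1) = (eta * lam i < 1 + b1).
  rewrite -subr_gt0 kfun_at1// pmulr_rgt0; last first.
    by rewrite !mulr_gt0 ?a0 ?subr_gt0.
  by rewrite subr_gt0 ltr_pdivrMr ?mul1r//; lra.
have F1 : eta * lam1 < 1 + b1 -> secular b1 a c 1 = S_adam eta b1 lam.
  by move=> /pos1 h; exact: secular_at1.
(* One implication for each position of [x] relative to 1; trichotomy then yields the converses in
   (b) and (c). *)
have x1 : x < 1 -> eta * lam1 < 1 + b1 /\ S_adam eta b1 lam < 1.
  move=> xlt; have [k1 Flt] := secular_lt _ _ _ _ _ hd hb1 bx xlt a0 kx.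
  have h : eta * lam1 < 1 + b1 by rewrite -f1.
  by split=> //; rewrite -F1//; rewrite Fx in Flt.
have x2 : eta * lam1 < 1 + b1 -> 1 < x -> 1 < S_adam eta b1 lam.
  move=> h xgt; rewrite -F1//.
  have k1 i : a i ^+ 2 < kfun b1 (c i) 1 by rewrite f1 pos1.
  by have [_] := secular_lt _ _ _ _ _ hd hb1 hb1' xgt a0 k1; rewrite Fx.
have x3 : x = 1 -> eta * lam1 < 1 + b1 /\ S_adam eta b1 lam = 1.
  move=> xe; have h : eta * lam1 < 1 + b1 by rewrite -f1 -xe.
  by split=> //; rewrite -F1// -[in LHS]xe.
rewrite rhoE sum_a2; split; [|split]; last 2 first.
- split=> // -[h S1]; case: (ltgtP x 1) => // xl.
    by have [_] := x1 xl; rewrite S1 ltxx.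
  by have := x2 h xl; rewrite S1 ltxx.
- split=> // -[h S1]; case: (ltgtP x 1) => // xl.
    by have := lt_trans S1 (x2 h xl); rewrite ltxx.
  by have [_ S1'] := x3 xl; rewrite S1' ltxx in S1.
split; first by move=> V; exact: Tadam_inK.
split=> //; split.
  exists W; split; first by move=> i; apply: adam_eigvec_psd.
  split=> //; split=> //; rewrite (bigD1 (Ordinal hd))//=.
  by rewrite ltr_pwDl// sumr_ge0// => i _; rewrite ltW.
split.
  (* Each denominator of [secular] is at most [x] by [kfun_le], and the secular sum is 1. *)
  have : \sum_i a i ^+ 2 / x <= secular b1 a c x.
    apply: ler_sum => i _; rewrite ler_pM2l ?exprn_gt0// lef_pV2 ?posrE ?f0//.
    by have := kfun_le _ (c i) _ hb1 bx; have := sqr_ge0 (a i); lra.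
  by rewrite Fx -mulr_suml ler_pdivrMr// mul1r.
rewrite (bigD1 (Ordinal hd))//= ltr_pwDl ?exprn_gt0// sumr_ge0// => i _.
exact: sqr_ge0.
Qed.
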